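(* Let $N\ge 1$ be an integer and let the $q$-hypergeometric Cauchy numbers $\mathcal C_{N,n}$ be defined by $\sum_{n=0}^\infty\mathcal C_{N,n}\frac{x^n}{n!}=\left(\sum_{j=0}^\infty(-1)^j\frac{[N]_q}{[N+j]_q}x^j\right)^{-1}$. For all $n\ge 1$, $$\mathcal C_{N,n}=n!\begin{vmatrix} \frac{[N]_q}{[N+1]_q}&1&0&&\\ \frac{[N]_q}{[N+2]_q}&\frac{[N]_q}{[N+1]_q}&1&&\\ \vdots&\vdots&\ddots&1&0\\ \frac{[N]_q}{[N+n-1]_q}&\frac{[N]_q}{[N+n-2]_q}&\cdots&\frac{[N]_q}{[N+1]_q}&1\\ \frac{[N]_q}{[N+n]_q}&\frac{[N]_q}{[N+n-1]_q}&\cdots&\frac{[N]_q}{[N+2]_q}&\frac{[N]_q}{[N+1]_q} \end{vmatrix},$$ where the $n\times n$ matrix has $(i,j)$ entry $\frac{[N]_q}{[N+i-j+1]_q}$ if $i\ge j$, $1$ if $j=i+1$, and $0$ if $j>i+1$.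
   Context: $q\ne 1$ is a complex number that is not a root of unity; $[n]_q=\frac{1-q^n}{1-q}$. Generating functions are formal power series in $x$. For $N=1$ the generating function is $x/\mathrm{Log}_q(1+x)$ with $\mathrm{Log}_q(1+z)=\sum_{n\ge1}\frac{(-1)^{n-1}z^n}{[n]_q}$. *)

(* Defs.v *)
From mathcomp Require Import all_boot all_order all_algebra.
From mathcomp Require Import reals complex.

Set Implicit Arguments.
Unset Strict Implicit.
Unset Printing Implicit Defensive.

Import GRing.Theory.
Local Open Scope ring_scope.

Definition qnum (K : fieldType) (q : K) (n : nat) : K :=
  (1 - q ^+ n) / (1 - q).

(* A formal power series over K is the sequence of its coefficients, and
   equality of series is pointwise equality [=1]. *)
Section FormalPowerSeries.
Variable K : fieldType.

Definition fps := nat -> K.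

Definition fps_one : fps := fun n => (n == 0)%:R.

Definition fps_mul (a b : fps) : fps :=
  fun n => \sum_(i < n.+1) a i * b (n - i)%N.

(* [:: b_0; ...; b_n] for b = a^-1, with b_0 = a_0^-1 and
   b_(m+1) = - a_0^-1 * \sum_(i <= m) a_(m+1-i) b_i. *)
Fixpoint fps_inv_seq (a : fps) (n : nat) : seq K :=
  if n is m.+1 then
    let s := fps_inv_seq a m in
    rcons s (- ((a 0)^-1 * \sum_(i < m.+1) a (m.+1 - i)%N * s`_i))
  else [:: (a 0)^-1].

(* The multiplicative inverse of a, meaningful when a 0 != 0: see fps_invP. *)
Definition fps_inv (a : fps) : fps := fun n => (fps_inv_seq a n)`_n.

(* The exponential generating function \sum_n c_n x^n / n!. *)
Definition fps_egf (c : nat -> K) : fps := fun n => c n / n`!%:R.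

Lemma size_fps_inv_seq a n : size (fps_inv_seq a n) = n.+1.
Proof. by elim: n => //= n IHn; rewrite size_rcons IHn. Qed.

Lemma nth_fps_inv_seq a n i : (i <= n)%N -> (fps_inv_seq a n)`_i = fps_inv a i.
Proof.
elim: n => [|n IHn]; first by case: i.
rewrite leq_eqVlt => /predU1P[-> //|lt_in].
by rewrite /= nth_rcons size_fps_inv_seq lt_in IHn.
Qed.

Lemma fps_inv0 a : fps_inv a 0 = (a 0)^-1. Proof. by []. Qed.

Lemma fps_invS a n : fps_inv a n.+1 =
  - ((a 0)^-1 * \sum_(i < n.+1) a (n.+1 - i)%N * fps_inv a i).
Proof.
rewrite {1}/fps_inv /= nth_rcons size_fps_inv_seq ltnn eqxx.
by congr (- (_ * _)); apply: eq_bigr => i _; rewrite nth_fps_inv_seq // -ltnS.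
Qed.

Lemma fps_mulC a b : fps_mul a b =1 fps_mul b a.
Proof.
move=> n; rewrite /fps_mul (reindex_inj rev_ord_inj) /=.
by apply: eq_bigr => i _; rewrite subSS subKn -1?ltnS // mulrC.
Qed.

Lemma fps_invP a b : a 0 != 0 -> (fps_mul a b =1 fps_one) <-> (b =1 fps_inv a).
Proof.
move=> a0; have rec n : fps_mul a b n.+1 =
    \sum_(i < n.+1) a (n.+1 - i)%N * b i + a 0 * b n.+1.
  rewrite fps_mulC /fps_mul big_ord_recr /= subnn [b _ * _]mulrC; congr (_ + _).
  by apply: eq_bigr => i _; rewrite mulrC.
have b0 : fps_mul a b 0 = a 0 * b 0 by rewrite /fps_mul big_ord1.
split=> [ab1 n | bE [|n]].
- elim/ltn_ind: n => -[|n] IHn.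
    by apply: (mulfI a0); rewrite -b0 ab1 fps_inv0 divff.
  apply: (mulfI a0); move/eqP: (ab1 n.+1); rewrite rec /fps_one /= addrC addr_eq0.
  move=> /eqP->; rewrite fps_invS mulrN mulVKf //; congr (- _).
  by apply: eq_bigr => i _; rewrite IHn.
- by rewrite b0 bE fps_inv0 divff.
- rewrite rec bE fps_invS mulrN mulVKf //.
  by under eq_bigr => i _ do rewrite bE; rewrite subrr.
Qed.

End FormalPowerSeries.

Definition qhyp_series (K : fieldType) (q : K) (N : nat) : fps K :=
  fun j => (-1) ^+ j * (qnum q N / qnum q (N + j)).

(* The numbers C_{N,n} with \sum_n C_{N,n} x^n / n! = (qhyp_series q N)^-1:
   see qhyp_cauchy_egf. *)
Definition qhyp_cauchy (K : fieldType) (q : K) (N n : nat) : K :=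
  n`!%:R * fps_inv (qhyp_series q N) n.

Lemma qhyp_cauchy_egf (K : numFieldType) (q : K) (N : nat) :
  fps_egf (qhyp_cauchy q N) =1 fps_inv (qhyp_series q N).
Proof.
move=> n; rewrite /fps_egf /qhyp_cauchy mulrC mulKf //.
by rewrite Num.Theory.pnatr_eq0 -lt0n fact_gt0.
Qed.

Lemma qnum_neq0 (K : fieldType) (q : K) (n : nat) :
  (forall k, (0 < k)%N -> ~~ k.-unity_root q) -> (0 < n)%N -> qnum q n != 0.
Proof.
have nz k : ~~ k.-unity_root q -> 1 - q ^+ k != 0.
  by apply: contra; rewrite unity_rootE subr_eq0 eq_sym.
move=> hq n_gt0; rewrite mulf_neq0 ?invr_eq0 ?nz ?hq //.
by have := nz 1 (hq 1 isT); rewrite expr1.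
Qed.

Lemma qhyp_series0 (K : fieldType) (q : K) (N : nat) :
  (forall k, (0 < k)%N -> ~~ k.-unity_root q) -> (0 < N)%N ->
  qhyp_series q N 0 = 1.
Proof.
by move=> hq N_gt0; rewrite /qhyp_series expr0 mul1r addn0 divff // qnum_neq0.
Qed.

(* Main.v *)
Require Import Defs.
From mathcomp Require Import all_boot all_order all_algebra.
From mathcomp Require Import reals complex.
Import GRing.Theory.
Local Open Scope ring_scope.

(** The first [n.+1] coefficients of [1 / a] are the solution [v] of the linear
    system [T v = e_0], where [T] is the lower triangular Toeplitz matrix with
    entries [a (i - j)].  Cramer's rule gives the last coordinate of [v] as the
    cofactor of [T] at row [0] and column [n], divided by
    [\det T = a 0 ^+ n.+1].  Deleting the first row and the last column of [T]
    leaves a Hessenberg matrix with [a 0] just above the diagonal: this is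
    Wronski's formula [fps_inv_det], valid for every invertible series.

    For the series at hand, [a k] is [(-1) ^+ k] times [[N]_q / [N + k]_q], so
    the sign of entry [(i, j)] is the product of a sign depending on [i] and one
    depending on [j].  Pulling these out of the rows and columns
    ([det_scale_rows_cols]) produces [(-1) ^+ n], which cancels the sign of the
    cofactor, and [a 0 = 1] puts ones above the diagonal. *)

Definition lower_toeplitz {K : fieldType} (a : fps K) (n : nat) : 'M[K]_n :=
  \matrix_(i, j) if (j <= i)%N then a (i - j)%N else 0.

Lemma det_lower_toeplitz (K : fieldType) (a : fps K) (n : nat) :
  \det (lower_toeplitz a n) = a 0 ^+ n.
Proof.
rewrite det_trig; last first.
  by apply/is_trig_mxP => i j lt_ij; rewrite mxE leqNgt lt_ij.
under eq_bigr => i _ do rewrite mxE leqnn subnn.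
by rewrite prodr_const card_ord.
Qed.

(** Multiplying series amounts to multiplying truncated coefficient vectors by
    a Toeplitz matrix, because a coefficient of the product only involves
    coefficients of no larger index. *)
Lemma mul_lower_toeplitz_col (K : fieldType) (a b : fps K) (n : nat) :
  lower_toeplitz a n *m (\col_(i < n) b i) = \col_(i < n) fps_mul a b i.
Proof.
apply/colP => i; rewrite !mxE fps_mulC /fps_mul.
rewrite (big_ord_widen n (fun k : nat => b k * a (i - k)%N)) // [RHS]big_mkcond.
apply: eq_bigr => j _; rewrite !mxE ltnS.
by case: ifP => _; rewrite ?mul0r // mulrC.
Qed.

(** Wronski's formula: Cramer's rule for the last unknown of the triangular
    system that expresses [a * a^-1 = 1]. *)
Lemma fps_inv_det (K : fieldType) (a : fps K) (n : nat) : a 0 != 0 ->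
  a 0 ^+ n.+1 * fps_inv a n =
  (-1) ^+ n * \det (\matrix_(i < n, j < n)
    if (j <= i.+1)%N then a (i.+1 - j)%N else 0).
Proof.
move=> a0; set T := lower_toeplitz a n.+1; set v := \col_(i < n.+1) fps_inv a i.
have Tv : T *m v = delta_mx 0 0.
  rewrite mul_lower_toeplitz_col; apply/colP => i; rewrite !mxE andbT.
  by have [_ ->] := fps_invP (fps_inv a) a0.
have /colP/(_ ord_max) : \adj T *m (T *m v) = \det T *: v.
  by rewrite mulmxA mul_adj_mx mul_scalar_mx.
rewrite Tv -colE det_lower_toeplitz !mxE => <-.
rewrite /cofactor add0n; congr (_ * \det _).
apply/matrixP => i j; rewrite !mxE lift0.
by rewrite lift_max.
Qed.

Lemma det_scale_rows_cols (K : fieldType) (n : nat) (u w : 'I_n -> K)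
    (A : 'M[K]_n) :
  \det (\matrix_(i, j) (u i * A i j * w j)) =
  (\prod_i (u i * w i)) * \det A.
Proof.
have -> : \matrix_(i, j) (u i * A i j * w j) =
    diag_mx (\row_i u i) *m A *m diag_mx (\row_i w i).
  by rewrite mul_diag_mx mul_mx_diag; apply/matrixP => i j; rewrite !mxE.
rewrite !det_mulmx !det_diag big_split /= mulrAC.
by congr (_ * _ * _); apply: eq_bigr => i _; rewrite mxE.
Qed.

(** The two alternations of sign, in the coefficients of the series and in
    Wronski's formula, cancel. *)
Lemma fps_inv_alternating (K : fieldType) (r : nat -> K) (n : nat) :
  r 0 = 1 ->
  fps_inv (fun k => (-1) ^+ k * r k) n =
  \det (\matrix_(i < n, j < n)
    if (j <= i.+1)%N then r (i.+1 - j)%N else 0).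
Proof.
move=> r0; set a : fps K := fun k => _.
have a0 : a 0 = 1 by rewrite /a expr0 mul1r.
have := @fps_inv_det K a n; rewrite a0 expr1n mul1r => ->; last exact: oner_neq0.
set A := (X in _ = \det X).
(* The sign (-1)^(i+1-j) splits as (-1)^(i+1) * (-1)^j. *)
have -> : \matrix_(i < n, j < n) (if (j <= i.+1)%N then a (i.+1 - j)%N else 0) =
    \matrix_(i < n, j < n) ((-1) ^+ i.+1 * A i j * (-1) ^+ j).
  apply/matrixP => i j; rewrite !mxE; case: ifP => [le_ji|_].
    by rewrite /a mulrAC -exprD -signr_odd oddB // -oddD signr_odd.
  by rewrite mulr0 mul0r.
rewrite (det_scale_rows_cols _ _ (fun i => (-1) ^+ i.+1) (fun i => (-1) ^+ i)).
under eq_bigr => i _ do rewrite exprS -mulrA -expr2 sqrr_sign mulr1.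
by rewrite prodr_const card_ord mulrA -expr2 sqrr_sign mul1r.
Qed.

Theorem theorem4 (R : realType) (q : R[i])
    (hq1 : q != 1)
    (hq : forall k : nat, (0 < k)%N -> ~~ k.-unity_root q)
    (N : nat) (hN : (1 <= N)%N) (n : nat) (hn : (1 <= n)%N) :
  qhyp_cauchy q N n =
  n`!%:R * \det (\matrix_(i < n, j < n)
    if (j <= i)%N then qnum q N / qnum q (N + (i - j) + 1)
    else if j == i.+1 :> nat then 1
    else 0).
Proof.
have r0 : qnum q N / qnum q (N + 0) = 1.
  by rewrite addn0 divff // qnum_neq0.
rewrite /qhyp_cauchy; congr (_ * _).
rewrite (fps_inv_alternating _ (fun k => qnum q N / qnum q (N + k)) n r0).
congr (\det _); apply/matrixP => i j; rewrite !mxE.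
case: (ltngtP j i.+1) => [|lt_ij|->].
- by rewrite ltnS => le_ji; rewrite le_ji -addnA addn1 subSn.
- by rewrite leqNgt (ltn_trans _ lt_ij).
- by rewrite ltnn subnn r0.
Qed.
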